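(* Let $F=F(S)$ be the free group over a set $S$ with $|S|\geq 2$. The real vector space $\mathrm{H}^2_{\mathrm{b}}(F,\mathbb{R})$ has infinite dimension.
   Context: Bounded cohomology: for a group $\Gamma$, let $C^n_{\mathrm{b}}(\Gamma)$ be the space of bounded maps $\Gamma^n\to\mathbb{R}$. The coboundary maps (trivial real coefficients) are, in the relevant degrees, $\partial f(x,y)=f(y)-f(xy)+f(x)$ for $f\in C^1_{\mathrm{b}}(\Gamma)$ and $\partial f(x,y,z)=f(y,z)-f(xy,z)+f(x,yz)-f(x,y)$ for $f\in C^2_{\mathrm{b}}(\Gamma)$. Then $\mathrm{H}^2_{\mathrm{b}}(\Gamma,\mathbb{R})=\ker(\partial:C^2_{\mathrm{b}}(\Gamma)\to C^3_{\mathrm{b}}(\Gamma))/\mathrm{im}(\partial:C^1_{\mathrm{b}}(\Gamma)\to C^2_{\mathrm{b}}(\Gamma))$. *)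

(* Defs.v *)
From HB Require Import structures.
From mathcomp Require Import all_boot all_order all_algebra.
From mathcomp Require Import all_classical reals topology normedtype.
From mathcomp Require Import ring.

Set Implicit Arguments.
Unset Strict Implicit.
Unset Printing Implicit Defensive.
Import Order.TTheory GRing.Theory Num.Theory numFieldNormedType.Exports.
Local Open Scope ring_scope.

(* The free group on S, as the group of reduced words in the letters s and
   s^-1 for s : S; the letter (s, e) stands for s^-1 when e is true. *)
Section FreeGroup.
Variable S : choiceType.

Definition letter : Type := S * bool.
HB.instance Definition _ := Choice.on letter.
Implicit Types (a b : letter) (u v w : seq letter).

Definition letter_inv a : letter := (a.1, ~~ a.2).

Definition reduced w := sorted (fun a b => b != letter_inv a) w.

Lemma letter_invK : involutive letter_inv.
Proof. by case=> s e; rewrite /letter_inv /= negbK. Qed.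

Lemma letter_inv_neq a : letter_inv a != a.
Proof. by case: a => s [] ; rewrite /letter_inv xpair_eqE /= eqxx. Qed.

Definition lmul a w :=
  if w is b :: w' then (if b == letter_inv a then w' else a :: w) else [:: a].

Definition word_mul u v := foldr lmul v u.
Definition word_inv u := rev (map letter_inv u).

Lemma reduced_tl a w : reduced (a :: w) -> reduced w.
Proof. exact: path_sorted. Qed.

Lemma reduced_lmul a w : reduced w -> reduced (lmul a w).
Proof.
case: w => [//|b w] rw /=; case: ifP => [_|/negbT nba]; first exact: reduced_tl rw.
by rewrite /reduced /= nba.
Qed.

Lemma lmul_reduced a w : reduced (a :: w) -> lmul a w = a :: w.
Proof. by case: w => //= b w /andP[/negPf ->]. Qed.

Lemma lmulK a w : reduced w -> lmul (letter_inv a) (lmul a w) = w.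
Proof.
case: w => [|b w] rw /=; first by rewrite letter_invK eqxx.
case: ifP => [/eqP eb|_]; last by rewrite /= letter_invK eqxx.
by rewrite lmul_reduced -?eb.
Qed.

Lemma lmulVK a w : reduced w -> lmul a (lmul (letter_inv a) w) = w.
Proof. by move=> rw; rewrite -{1}[a]letter_invK lmulK. Qed.

Lemma reduced_word_mul u v : reduced v -> reduced (word_mul u v).
Proof. by move=> rv; elim: u => [|a u IH] //=; exact: reduced_lmul. Qed.

Lemma reduced_word_inv u : reduced u -> reduced (word_inv u).
Proof.
move=> ru; rewrite /reduced /word_inv rev_sorted sorted_map.
congr is_true: ru; case: u => //= a u; apply: eq_path => x y /=.
by rewrite letter_invK eq_sym; apply/idP/idP; apply: contraNneq => <-;
   rewrite ?letter_invK.
Qed.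

Lemma word_mul_lmul a u w :
  reduced w -> word_mul (lmul a u) w = lmul a (word_mul u w).
Proof.
move=> rw; case: u => [//|b u] /=; case: ifP => [/eqP ->|//].
by rewrite lmulVK ?reduced_word_mul.
Qed.

Lemma word_mulA u v w :
  reduced w -> word_mul u (word_mul v w) = word_mul (word_mul u v) w.
Proof.
by move=> rw; elim: u => //= a u IH; rewrite word_mul_lmul // IH.
Qed.

Lemma word_mulr1 u : reduced u -> word_mul u [::] = u.
Proof.
elim: u => //= a u IH ru.
by rewrite IH ?(reduced_tl ru) // lmul_reduced.
Qed.

Lemma word_mulVw u w : reduced w -> word_mul (word_inv u) (word_mul u w) = w.
Proof.
move=> rw; elim: u => //= a u IH.
rewrite /word_inv /= rev_cons /word_mul foldr_rcons lmulK ?reduced_word_mul //.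
Qed.

Lemma word_invK : involutive word_inv.
Proof.
move=> u; rewrite /word_inv map_rev revK -map_comp -[RHS]map_id.
by apply: eq_map => a /=; exact: letter_invK.
Qed.

Record free_group : Type := FreeGroup {
  word :> seq letter;
  word_reduced : reduced word
}.

HB.instance Definition _ := [isSub for word].
HB.instance Definition _ := [Choice of free_group by <:].

Definition fg_one : free_group := @FreeGroup [::] isT.
Definition fg_mul (x y : free_group) : free_group :=
  FreeGroup (reduced_word_mul x (word_reduced y)).
Definition fg_inv (x : free_group) : free_group :=
  FreeGroup (reduced_word_inv (word_reduced x)).

Lemma fg_mulA : associative fg_mul.
Proof. by move=> x y z; apply: val_inj; exact: (word_mulA x y (word_reduced z)). Qed.
Lemma fg_mul1g : left_id fg_one fg_mul.
Proof. by move=> x; exact: val_inj. Qed.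
Lemma fg_mulg1 : right_id fg_one fg_mul.
Proof. by move=> x; apply: val_inj; exact: (word_mulr1 (word_reduced x)). Qed.
Lemma fg_mulVg : left_inverse fg_one fg_inv fg_mul.
Proof.
move=> x; apply: val_inj; rewrite /= -{2}(word_mulr1 (word_reduced x)).
exact: word_mulVw.
Qed.
Lemma fg_mulgV : right_inverse fg_one fg_inv fg_mul.
Proof.
move=> x; apply: val_inj; rewrite /= -{1}[word x]word_invK.
rewrite -[X in word_mul _ X](word_mulr1 (reduced_word_inv (word_reduced x))).
exact: word_mulVw.
Qed.

HB.instance Definition _ :=
  isGroup.Build free_group fg_mulA fg_mul1g fg_mulg1 fg_mulVg fg_mulgV.

Definition fg_gen (s : S) : free_group := @FreeGroup [:: (s, false)] isT.

Section Universal.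
Local Open Scope group_scope.
Variables (G : groupType) (f : S -> G).

Definition letter_eval a : G := if a.2 then (f a.1)^-1 else f a.1.
Definition fg_lift (x : free_group) : G :=
  \prod_(a <- word x) letter_eval a.

Lemma letter_evalV a : letter_eval (letter_inv a) = (letter_eval a)^-1.
Proof. by case: a => s []; rewrite /letter_eval /= ?invgK. Qed.

Lemma eval_lmul a w :
  \prod_(b <- lmul a w) letter_eval b =
  letter_eval a * \prod_(b <- w) letter_eval b.
Proof.
case: w => [|b w] /=; first by rewrite big_cons.
case: ifP => [/eqP ->|_]; last by rewrite big_cons.
by rewrite big_cons letter_evalV mulVKg.
Qed.

Lemma fg_liftM : {morph fg_lift : x y / x * y}.
Proof.
move=> x y; rewrite /fg_lift /=; elim: (word x) => [|a u IH] /=.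
  by rewrite big_nil mul1g.
by rewrite eval_lmul IH big_cons mulgA.
Qed.

Lemma fg_lift_gen s : fg_lift (fg_gen s) = f s.
Proof. by rewrite /fg_lift big_seq1. Qed.

Lemma fg_lift_unique (h : free_group -> G) :
  {morph h : x y / x * y} -> (forall s, h (fg_gen s) = f s) -> h =1 fg_lift.
Proof.
move=> hM hf; have h1 : h 1 = 1.
  by apply: (mulgI (h 1)); rewrite -hM !mulg1.
have hV x : h x^-1 = (h x)^-1.
  by apply: (mulgI (h x)); rewrite -hM !mulgV.
case; elim=> [|a u IH] ru.
  by rewrite /fg_lift big_nil -[RHS]h1; congr h; exact: val_inj.
pose y := FreeGroup (reduced_tl ru); pose x := @FreeGroup [:: a] isT.
have -> : FreeGroup ru = x * y by apply: val_inj; rewrite /= lmul_reduced.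
rewrite hM fg_liftM IH; congr (_ * _).
rewrite /fg_lift big_seq1 /x /letter_eval; case: (a) => s [] /=; rewrite -hf //.
by rewrite -hV; congr h; exact: val_inj.
Qed.

End Universal.
End FreeGroup.

Section LmoduleQuotient.
Local Open Scope quotient_scope.
Variables (K : nzRingType) (V : lmodType K) (W : submodClosed V).

(* A submodClosed structure does not record stability under opposites, which
   Quotient.quot needs, so we add it. *)
Definition submod_pred : V -> bool := fun v => v \in W.

Lemma submod_pred_zmod : zmod_closed submod_pred.
Proof. exact: (GRing.submod_closedB (submodClosedP W)). Qed.
HB.instance Definition _ :=
  GRing.isZmodClosed.Build V submod_pred submod_pred_zmod.

Definition submod_zmod : zmodClosed V := GRing.ZmodClosed.clone V submod_pred _.

Definition lmod_quot : Type := Quotient.quot submod_zmod.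
HB.instance Definition _ := GRing.Zmodule.on lmod_quot.
HB.instance Definition _ := EqQuotient.on lmod_quot.

Definition lmod_quot_scale (k : K) (x : lmod_quot) : lmod_quot :=
  \pi_lmod_quot (k *: repr x).

Lemma lmod_quot_eqP (x y : V) :
  reflect (\pi_lmod_quot x = \pi_lmod_quot y) (x - y \in W).
Proof.
have eW : (x - y \in W) = (x - y \in submod_zmod) by [].
have e1 := (@Quotient.idealrBE V submod_zmod x y).
rewrite eW e1.
exact: eqP.
Qed.

Lemma lmod_quot_piD (x y : V) :
  \pi_lmod_quot (x + y) = \pi_lmod_quot x + \pi_lmod_quot y.
Proof. exact: (@Quotient.pi_add V submod_zmod). Qed.

Lemma lmod_quot_piZ k (x : V) :
  \pi_lmod_quot (k *: x) = lmod_quot_scale k (\pi_lmod_quot x).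
Proof.
apply/lmod_quot_eqP; rewrite -scalerBr; apply: rpredZ.
by apply/lmod_quot_eqP; rewrite reprK.
Qed.

Lemma lmod_quot_scalerA k l x :
  lmod_quot_scale k (lmod_quot_scale l x) = lmod_quot_scale (k * l) x.
Proof.
elim/quotW: x => x.
by rewrite -(lmod_quot_piZ l) -(lmod_quot_piZ k) -(lmod_quot_piZ (k * l)) scalerA.
Qed.
Lemma lmod_quot_scale1r : left_id 1 lmod_quot_scale.
Proof. by elim/quotW=> x; rewrite -lmod_quot_piZ scale1r. Qed.
Lemma lmod_quot_scalerDr : right_distributive lmod_quot_scale +%R.
Proof.
move=> k; elim/quotW=> x; elim/quotW=> y.
rewrite -lmod_quot_piD -(lmod_quot_piZ k (x + y)) -(lmod_quot_piZ k x).
by rewrite -(lmod_quot_piZ k y) scalerDr lmod_quot_piD.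
Qed.
Lemma lmod_quot_scalerDl x : {morph lmod_quot_scale^~ x : k l / k + l}.
Proof.
move=> k l; elim/quotW: x => x /=.
rewrite -(lmod_quot_piZ (k + l)) -(lmod_quot_piZ k) -(lmod_quot_piZ l).
by rewrite scalerDl lmod_quot_piD.
Qed.
HB.instance Definition _ := GRing.Zmodule_isLmodule.Build K lmod_quot
  lmod_quot_scalerA lmod_quot_scale1r lmod_quot_scalerDr lmod_quot_scalerDl.

Lemma lmod_quot_pi_linear : linear (\pi_lmod_quot : V -> lmod_quot).
Proof. by move=> k x y; rewrite lmod_quot_piD lmod_quot_piZ. Qed.

End LmoduleQuotient.

Definition finite_dimensional (K : fieldType) (V : lmodType K) : Prop :=
  exists s : seq V, forall v : V,
    exists c : 'I_(size s) -> K, v = \sum_(i < size s) c i *: s`_i.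

Definition infinite_dimensional (K : fieldType) (V : lmodType K) : Prop :=
  ~ finite_dimensional V.

Lemma bounded_fun_le (R : realType) (T : Type) (f : T -> R) :
  bounded_fun f <-> exists M : R, forall x, `|f x| <= M.
Proof.
split=> [[M [_ fM]]|[M fM]].
  by exists (M + 1) => x; apply: (fM (M + 1)) => //; rewrite ltrDl.
by exists M; split=> [|N MN x _ /=]; rewrite ?num_real // (le_trans (fM x)) ?ltW.
Qed.

Section BoundedCohomology.
Variables (G : groupType) (R : realType).

Section Cochains.
Variable n : nat.

Definition bounded_pred : {pred n.-tuple G -> R} :=
  fun f => `[< bounded_fun f >].

Lemma bounded_pred_submod : submod_closed bounded_pred.
Proof.
split=> [|k f g]; first by apply/asboolP; exact: (bounded_cst (0 : R)).
move=> /asboolP/bounded_fun_le[M fM] /asboolP/bounded_fun_le[N gN].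
apply/asboolP/bounded_fun_le; exists (`|k| * M + N) => x.
apply: (le_trans (ler_normD _ _)); apply: lerD => //.
by rewrite normrM ler_wpM2l.
Qed.
HB.instance Definition _ :=
  GRing.isSubmodClosed.Build R _ bounded_pred bounded_pred_submod.

Record bounded_cochain : Type := BoundedCochain {
  cochain_fun :> n.-tuple G -> R;
  cochain_bounded : cochain_fun \in bounded_pred
}.
HB.instance Definition _ := [isSub for cochain_fun].
HB.instance Definition _ := [Choice of bounded_cochain by <:].
HB.instance Definition _ := [SubChoice_isSubLmodule of bounded_cochain by <:].

Lemma bounded_cochainP (f : bounded_cochain) : exists M, forall t, `|f t| <= M.
Proof. by apply/bounded_fun_le/asboolP; exact: cochain_bounded. Qed.

End Cochains.
Arguments bounded_pred n : clear implicits.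

Definition coboundary1_fun (f : 1.-tuple G -> R) : 2.-tuple G -> R := fun t =>
  let x := [tnth t 0] in let y := [tnth t 1] in
  f [tuple y] - f [tuple (x * y)%g] + f [tuple x].

Definition coboundary2_fun (f : 2.-tuple G -> R) : 3.-tuple G -> R := fun t =>
  let x := [tnth t 0] in let y := [tnth t 1] in let z := [tnth t 2] in
  f [tuple y; z] - f [tuple (x * y)%g; z] + f [tuple x; (y * z)%g]
  - f [tuple x; y].

Lemma coboundary1_bounded (f : bounded_cochain 1) : coboundary1_fun f \in bounded_pred 2.
Proof.
apply/asboolP/bounded_fun_le; have [M fM] := bounded_cochainP f.
exists (M + M + M) => t; rewrite /coboundary1_fun.
by rewrite !(le_trans (ler_normD _ _), lerD) ?normrN.
Qed.

Lemma coboundary2_bounded (f : bounded_cochain 2) : coboundary2_fun f \in bounded_pred 3.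
Proof.
apply/asboolP/bounded_fun_le; have [M fM] := bounded_cochainP f.
exists (M + M + M + M) => t; rewrite /coboundary2_fun.
by rewrite !(le_trans (ler_normD _ _), lerD) ?normrN.
Qed.

Definition coboundary1 (f : bounded_cochain 1) : bounded_cochain 2 :=
  BoundedCochain (coboundary1_bounded f).
Definition coboundary2 (f : bounded_cochain 2) : bounded_cochain 3 :=
  BoundedCochain (coboundary2_bounded f).

Lemma coboundary1_linear : linear coboundary1.
Proof.
move=> k f g; apply/val_inj/funext => t.
rewrite /= /coboundary1_fun /= !fctE /=.
rewrite scalerDr scalerBr; ring.
Qed.
HB.instance Definition _ := GRing.isLinear.Build R _ _ _ coboundary1 coboundary1_linear.

Lemma coboundary2_linear : linear coboundary2.
Proof.
move=> k f g; apply/val_inj/funext => t.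
rewrite /= /coboundary2_fun /= !fctE /=.
rewrite !(scalerDr, scalerN); ring.
Qed.
HB.instance Definition _ := GRing.isLinear.Build R _ _ _ coboundary2 coboundary2_linear.

Lemma coboundary2_coboundary1 (f : bounded_cochain 1) : coboundary2 (coboundary1 f) = 0.
Proof.
apply/val_inj/funext => t; rewrite /= /coboundary2_fun /= /coboundary1_fun /= !(tnth_nth 1%g) /= mulgA.
by rewrite [RHS]/GRing.zero /=; ring.
Qed.

Definition cocycle_pred : {pred bounded_cochain 2} := fun f => coboundary2 f == 0.

Lemma cocycle_pred_submod : submod_closed cocycle_pred.
Proof.
split=> [|k f g /eqP df /eqP dg]; apply/eqP; first exact: linear0.
by rewrite linearP /= df dg scaler0 addr0.
Qed.
HB.instance Definition _ :=
  GRing.isSubmodClosed.Build R _ cocycle_pred cocycle_pred_submod.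

Record bounded_cocycle : Type := BoundedCocycle {
  cocycle_cochain :> bounded_cochain 2;
  cocycleP : cocycle_cochain \in cocycle_pred
}.
HB.instance Definition _ := [isSub for cocycle_cochain].
HB.instance Definition _ := [Choice of bounded_cocycle by <:].
HB.instance Definition _ := [SubChoice_isSubLmodule of bounded_cocycle by <:].

Definition coboundary_pred : {pred bounded_cocycle} :=
  fun c => `[< exists f : bounded_cochain 1, cocycle_cochain c = coboundary1 f >].

Lemma coboundary_pred_submod : submod_closed coboundary_pred.
Proof.
split=> [|k b c /asboolP[f bf] /asboolP[g cg]]; apply/asboolP.
  by exists 0; rewrite linear0.
by exists (k *: f + g); rewrite linearP /= -bf -cg.
Qed.
HB.instance Definition _ :=
  GRing.isSubmodClosed.Build R _ coboundary_pred coboundary_pred_submod.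

Definition Hb2 : Type := lmod_quot coboundary_pred.
HB.instance Definition _ := GRing.Lmodule.on Hb2.

End BoundedCohomology.

(* Main.v *)
Require Import Defs.
From HB Require Import structures.
From mathcomp Require Import all_boot all_order all_algebra.
From mathcomp Require Import all_classical reals topology normedtype.
From mathcomp Require Import ring lra zify.

Set Implicit Arguments.
Unset Strict Implicit.
Unset Printing Implicit Defensive.
Import Order.TTheory GRing.Theory Num.Theory.
Local Open Scope ring_scope.

(** A map phi on a group with bounded defect phi x + phi y - phi (x y) is a
quasimorphism; its coboundary is a bounded 2-cocycle, whose class in bounded
cohomology vanishes exactly when phi lies at bounded distance from a
homomorphism.  It suffices to produce infinitely many quasimorphisms on the
free group of which no nontrivial linear combination is near a homomorphism.

These are Brooks' counting quasimorphisms.  For a word p, let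
brooks p w = (occurrences of p in w) - (occurrences of p in w^-1).  It is odd
under inversion, and additive up to 2 |p| under concatenation of words, since
only the occurrences that straddle the junction are miscounted.  A product x y
in the free group is computed by writing x = u c and y = c^-1 v with
x y = u v; the contributions of c and c^-1 cancel by oddness, so the defect is
at most 6 |p| ([brooks_quasimorphism]).

Fix two distinct generators s and t, and take p_j = s t^(j+1) s.  Suppose that
sum_j c_j brooks p_j is within M of a homomorphism h ([sum_class_eq0]).  Every
p_j contains both s and t, so all the counts vanish on powers of s and on
powers of t; hence |h(s^m)| = m |h(s)| <= M for all m, so h(s) = 0, and
likewise h(t) = 0.  Therefore h vanishes on the words (s t^(k+1))^m s.  Such a
word contains p_k exactly m times, p_j for j <> k not at all, and has no
inverse letters ([occ_test_word], [brooks_gen_prod]); so m |c_k| <= M for all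
m, and c_k = 0. *)

(** * Counting occurrences of a word *)

Section Occurrences.
Variable T : eqType.
Implicit Types p u v w : seq T.

Fixpoint occ p w : nat :=
  if w is _ :: w' then (prefix p w + occ p w')%N else 0%N.

Lemma occ_cons p a w : occ p (a :: w) = (prefix p (a :: w) + occ p w)%N.
Proof. by []. Qed.

Lemma occ_cat_ge p u v : (occ p u + occ p v <= occ p (u ++ v))%N.
Proof.
elim: u => [//|a u IH]; rewrite cat_cons !occ_cons -addnA leq_add //.
have [/prefixP[w e]|//] := boolP (prefix p (a :: u)).
by rewrite -cat_cons e -catA prefix_prefix.
Qed.

(** An occurrence in u ++ v that lies in neither factor starts in u at distance
less than [size p] from its end.  The bound by [size u] is what makes the
induction go through while u is still shorter than p. *)
Lemma occ_cat_le p u v :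
  (occ p (u ++ v) <= occ p u + occ p v + minn (size u) (size p))%N.
Proof.
elim: u => [|a u IH]; first by rewrite /= min0n addn0.
have eqp : (size p <= (size u).+1)%N -> prefix p (a :: u ++ v) = prefix p (a :: u).
  by move=> pu; rewrite -cat_cons !prefixE takel_cat.
rewrite cat_cons !occ_cons [size (a :: u)]/=; have [/eqp ->|] := leqP (size p) (size u).+1; first by lia.
by move=> ?; case: (prefix p (a :: u ++ v)); lia.
Qed.

Lemma occ_eq0 p w a : a \in p -> a \notin w -> occ p w = 0%N.
Proof.
move=> ap; elim: w => [//|b w IH]; rewrite occ_cons inE negb_or => /andP[ab aw].
rewrite IH // addn0; apply/eqP; rewrite eqb0; apply/negP => /prefixP[v e].
have: a \in b :: w by rewrite e mem_cat ap.
by rewrite inE (negPf ab) (negPf aw).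
Qed.

End Occurrences.

Lemma occ_map (T T' : eqType) (f : T -> T') p w :
  injective f -> occ (map f p) (map f w) = occ p w.
Proof.
move=> f_inj; elim: w => [//|a w IH]; rewrite map_cons !occ_cons -IH; congr (nat_of_bool _ + _)%N.
by rewrite !prefixE -map_cons -map_take size_map inj_eq //; exact: inj_map.
Qed.

(** * Words that separate the counting functions *)

Section TestWords.
Variables (T : eqType) (s t : T).
(** The word s t^(j+1) s.  The exponent is positive so that both letters occur,
which makes its count vanish on powers of a single generator. *)
Definition marker j := s :: rcons (nseq j.+1 t) s.

(** The word (s t^(k+1))^n s. *)
Fixpoint test_word k n :=
  if n is n'.+1 then s :: nseq k.+1 t ++ test_word k n' else [:: s].

Lemma mem_marker j : (s \in marker j) && (t \in marker j).
Proof. rewrite /marker !inE. by rewrite eqxx /= mem_rcons !inE eqxx !orbT. Qed.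

Hypothesis neq_st : s != t.

(** The letter s that closes each block delimits it, so that only blocks of
equal length match. *)
Lemma prefix_block j k w :
  prefix (rcons (nseq j t) s) (nseq k t ++ s :: w) = (j == k).
Proof.
elim: j k => [|j IH] [|k] /=; rewrite ?eqxx ?prefix0s ?(negPf neq_st) ?IH //.
by rewrite eq_sym (negPf neq_st).
Qed.

Lemma occ_test_word j k n : occ (marker j) (test_word k n) = ((j == k) * n)%N.
Proof.
have [w] : exists w, test_word k n = s :: w by case: n; eexists.
elim: n => [|n IH] in w *; first by rewrite /= eqxx muln0.
move=> _; have [w' e] : exists w', test_word k n = s :: w' by case: (n); eexists.
rewrite [test_word _ _]/= occ_cons mulnS -{}(IH _ e); congr (_ + _)%N.
  rewrite e /marker prefix_cons eqxx; congr nat_of_bool; exact: (prefix_block j.+1 k.+1).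
rewrite -[t :: _]/(nseq k.+1 t ++ _); elim: k.+1 => // m.
by rewrite [nseq _ _]/= cat_cons occ_cons /marker prefix_cons (negPf neq_st).
Qed.

End TestWords.

(** * Counting quasimorphisms on the free group *)

Section Brooks.
Variables (R : realType) (S : choiceType).
Local Notation F := (free_group S).
Implicit Types (p u v w : seq (letter S)) (x y : F).

Lemma word_inv_cat u v : word_inv (u ++ v) = word_inv v ++ word_inv u.
Proof. by rewrite /word_inv map_cat rev_cat. Qed.

(** The cancelled part c is the longest suffix of u that is inverted by a prefix
of w.  Reducedness of u ensures that cancellation, once it stops, does not
resume. *)
Lemma word_mul_cancel u w : reduced u -> exists u' c v,
  [/\ u = u' ++ c, w = word_inv c ++ v & word_mul u w = u' ++ v].
Proof.
elim: u => [|a u IH] ru; first by exists [::], [::], w.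
have [u' [c [v [eu ew e]]]] := IH (reduced_tl ru).
rewrite /= e; case: u' eu {e} => [|b u'] eu.
  (* All of the tail of u has cancelled: the letter a meets the head of v. *)
  case: v ew => [|b v] ew /=.
    by exists [:: a], c, [::]; rewrite eu.
  case: eqP => [eb|_]; last by exists [:: a], c, (b :: v); rewrite eu.
  exists [::], (a :: c), v; split; rewrite ?eu //.
  by rewrite ew eb -(cat1s a c) word_inv_cat -catA.
exists (a :: b :: u'), c, v; rewrite eu ew; split=> //=.
by move: ru; rewrite eu /reduced /= => /andP[/negPf ->].
Qed.

Definition brooks p w : R := (occ p w)%:R - (occ p (word_inv w))%:R.

Lemma brooks_inv p w : brooks p (word_inv w) = - brooks p w.
Proof. by rewrite /brooks word_invK opprB. Qed.

Lemma occ_cat_near p u v :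
  `|(occ p (u ++ v))%:R - (occ p u)%:R - (occ p v)%:R : R| <= (size p)%:R.
Proof.
have := occ_cat_ge p u v; have := occ_cat_le p u v.
set a := occ p u; set b := occ p v; set c := occ _ _ => h1 h2.
have -> : c%:R - a%:R - b%:R = (c - (a + b))%N%:R :> R.
  by rewrite natrB // natrD opprD addrA.
by rewrite normr_nat ler_nat leq_subLR (leq_trans h1) // leq_add2l geq_minr.
Qed.

Lemma brooks_cat_near p u v :
  `|brooks p (u ++ v) - brooks p u - brooks p v| <= 2 * (size p)%:R.
Proof.
have := occ_cat_near p u v; have := occ_cat_near p (word_inv v) (word_inv u).
rewrite /brooks word_inv_cat !ler_norml => /andP[? ?] /andP[? ?].
by apply/andP; split; lra.
Qed.

End Brooks.

Definition quasimorphism (R : realType) (G : groupType) (phi : G -> R) : Prop :=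
  exists C, forall x y, `|phi y - phi (x * y)%g + phi x| <= C.

(** With x = u c, y = c^-1 v and x y = u v, near-additivity is used three times,
and the values at c and c^-1 cancel. *)
Lemma brooks_quasimorphism (R : realType) (S : choiceType) (p : seq (letter S)) :
  quasimorphism (fun x : free_group S => brooks R p x).
Proof.
exists (6 * (size p)%:R) => x y /=.
have [u [c [v [ex ey exy]]]] := word_mul_cancel y (word_reduced x).
rewrite exy ex ey.
have := brooks_cat_near R p u c; have := brooks_cat_near R p u v.
have := brooks_cat_near R p (word_inv c) v; rewrite brooks_inv.
rewrite !ler_norml => /andP[? ?] /andP[? ?] /andP[? ?].
by apply/andP; split; lra.
Qed.

(** * Classes of quasimorphisms in bounded cohomology *)

Section QuasimorphismClasses.
Variables (R : realType) (G : groupType).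
Implicit Types phi : G -> R.

Definition coboundary_fun phi : 2.-tuple G -> R :=
  coboundary1_fun (fun t => phi (thead t)).

Lemma coboundary_funE phi x y :
  coboundary_fun phi [tuple x; y] = phi y - phi (x * y)%g + phi x.
Proof. by rewrite /coboundary_fun /coboundary1_fun /thead !(tnth_nth 1%g). Qed.

Lemma quasimorphism_bounded phi :
  quasimorphism phi -> coboundary_fun phi \in @bounded_pred G R 2.
Proof.
move=> [C phiC]; apply/asboolP/bounded_fun_le; exists C => t.
by rewrite (_ : t = [tuple [tnth t 0]; [tnth t 1]]) ?coboundary_funE //;
   apply/eq_from_tnth; case=> [[|[|]]] //= ?; rewrite !(tnth_nth 1%g).
Qed.

Lemma coboundary_fun_cocycle phi (phiq : quasimorphism phi) :
  BoundedCochain (quasimorphism_bounded phiq) \in @cocycle_pred G R.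
Proof.
apply/eqP/val_inj/funext => t.
rewrite /= /coboundary2_fun /= !coboundary_funE mulgA.
by rewrite [RHS]/GRing.zero /=; ring.
Qed.

Definition quasimorphism_cocycle phi (phiq : quasimorphism phi) : bounded_cocycle G R :=
  BoundedCocycle (coboundary_fun_cocycle phiq).

Definition quasimorphism_class phi (phiq : quasimorphism phi) : Hb2 G R :=
  (\pi_(lmod_quot (coboundary_pred (R:=R)))%qT (quasimorphism_cocycle phiq)).

(** If the coboundary of Phi = sum_i c_i phi_i is also the coboundary of a bounded
f, then h = Phi - f has zero coboundary, that is, h is a homomorphism. *)
Lemma sum_class_eq0 n (c : 'I_n -> R) (phi : 'I_n -> G -> R)
    (phiq : forall i, quasimorphism (phi i)) :
  \sum_i c i *: quasimorphism_class (phiq i) = 0 ->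
  exists2 h : G -> R, {morph h : x y / (x * y)%g >-> x + y} &
    exists M, forall x, `|\sum_i c i * phi i x - h x| <= M.
Proof.
move=> sum0.
have pi0 : \pi_(lmod_quot (coboundary_pred (G:=G) (R:=R)))%qT 0 = 0.
  by rewrite -[0 in LHS](scale0r 0) lmod_quot_piZ; exact: (scale0r (_ : Hb2 G R)).
pose b : bounded_cocycle G R := \sum_i c i *: quasimorphism_cocycle (phiq i).
have : b \in coboundary_pred (R:=R).
  rewrite -[b]subr0; apply/lmod_quot_eqP; rewrite [RHS]pi0 -[RHS]sum0.
  rewrite (big_morph _ (@lmod_quot_piD _ _ _) pi0); apply: eq_bigr => i _.
  exact: lmod_quot_piZ.
move=> /asboolP[f bf]; have [M fM] := bounded_cochainP f.
exists (fun x => \sum_i c i * phi i x - f [tuple x]); last first.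
  by exists M => x; rewrite opprB addrC subrK.
move=> x y.
have : b [tuple x; y] = \sum_i c i * (phi i y - phi i (x * y)%g + phi i x).
  by rewrite /b (big_morph (fun z : bounded_cocycle G R => z [tuple x; y]) (id1 := 0) (op1 := +%R)).
rewrite bf /= /coboundary1_fun !(tnth_nth 1%g) /=.
under eq_bigr => i _ do rewrite mulrDr mulrBr.
rewrite big_split sumrB /=; lra.
Qed.

End QuasimorphismClasses.

(** * Infinite dimension from an independent sequence *)

(** Expressing d+1 of the vectors in a spanning family of size d gives a matrix
with more rows than columns, and a nonzero row vector that it kills is a linear
relation between those d+1 vectors. *)
Lemma infinite_dimensional_indep (K : fieldType) (V : lmodType K) (e : nat -> V) :
  (forall n (c : 'I_n -> K), \sum_i c i *: e i = 0 -> forall i, c i = 0) ->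
  infinite_dimensional V.
Proof.
move=> e_indep [s span]; have [C eC] := boolp.choice (fun i => span (e i)).
pose A : 'M[K]_((size s).+1, size s) := \matrix_(i, j) C i j.
have : kermx A != 0.
  by rewrite kermx_eq0 /row_free; apply/negP => /eqP rA; have := rank_leq_col A; lia.
case/rowV0Pn => c /sub_kermxP cA /rV0Pn[i]; apply/negP; rewrite negbK.
apply/eqP; apply: (e_indep _ (fun i => c 0 i)).
under eq_bigr do rewrite eC scaler_sumr.
rewrite exchange_big big1 // => j _.
under eq_bigr do rewrite scalerA.
have /matrixP/(_ 0 j) := cA; rewrite !mxE -scaler_suml => cAj.
rewrite (_ : \sum_i _ = 0) ?scale0r // -[RHS]cAj.
by apply: eq_bigr => k _; rewrite mxE.
Qed.

Lemma bounded_multiples_eq0 (R : realType) (a M : R) :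
  (forall n, `|n%:R * a| <= M) -> a = 0.
Proof.
move=> aM; apply/eqP; apply: contraT => a0.
have a_gt0 : 0 < `|a| by rewrite normr_gt0.
have [n nM] : exists n, M / `|a| < n%:R.
  by exists (Num.bound (M / `|a|)); rewrite archi_boundP // divr_ge0 // (le_trans _ (aM 0%N)).
have := aM n; rewrite normrM normr_nat; rewrite ltr_pdivrMr // in nM.
by rewrite leNgt nM.
Qed.

(** * Products of generators *)

Section PositiveWords.
Variables (S : choiceType).

Definition pos (r : S) : letter S := (r, false).

Lemma pos_inj : injective pos. Proof. by move=> ? ? []. Qed.

Definition gen_prod (w : seq S) : free_group S := (\prod_(r <- w) fg_gen r)%g.

(** Without inverse letters nothing cancels. *)
Lemma word_gen_prod w : word (gen_prod w) = map pos w.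
Proof.
rewrite /gen_prod; elim: w => [|r w IH]; first by rewrite big_nil.
rewrite big_cons /= IH; case: w {IH} => //= r' w.
by case: eqP => // -[].
Qed.

(** The inverse of a positive word has only negative letters, so it contributes
no occurrence of a nonempty positive word. *)
Lemma brooks_gen_prod (R : realType) r p w :
  brooks R (map pos (r :: p)) (gen_prod w) = (occ (r :: p) w)%:R.
Proof.
rewrite /brooks word_gen_prod occ_map; last exact: pos_inj.
rewrite (@occ_eq0 _ _ (word_inv _) (pos r)) ?subr0 ?mem_head //.
rewrite /word_inv mem_rev -map_comp; by apply/negP => /mapP[].
Qed.

End PositiveWords.

Theorem corollary2p3 (R : realType) (S : choiceType)
    (S_ge2 : ([set: 'I_2] #<= [set: S])%card) :
  infinite_dimensional (Hb2 (free_group S) R).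
Proof.
have [s [t neq_st]] : exists s t : S, s != t.
  have /card_leP[f] := S_ge2.
  pose g (i : 'I_2) := val (f (SigSub (mem_setT i))).
  exists (g 0), (g 1); apply/eqP => /val_inj e.
  have e01 := inj (in_setT _) (in_setT _) e; by have := congr1 (fun i => val (val i)) e01.
pose phi (j : nat) (x : free_group S) := brooks R (map (@pos S) (marker s t j)) x.
have phiq j : quasimorphism (phi j) by exact: brooks_quasimorphism.
apply: (@infinite_dimensional_indep _ _ (fun j => quasimorphism_class (phiq j))).
move=> n c /(sum_class_eq0 (phiq := fun i : 'I_n => phiq i))[h hM [M near]] k.
have h1 : h 1%g = 0.
  by have := hM 1%g 1%g; rewrite mulg1 => /(congr1 (fun z => z - h 1%g)); rewrite addrK subrr.
have hprod w : h (gen_prod w) = \sum_(r <- w) h (fg_gen r).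
  by rewrite /gen_prod (big_morph h hM h1).
have phi_prod i w : phi i (gen_prod w) = (occ (marker s t i) w)%:R.
  exact: brooks_gen_prod.
(* The counts vanish on powers of s and of t, so h is bounded there. *)
have h_gen r : (r == s) || (r == t) -> h (fg_gen r) = 0.
  move=> rst; apply: (@bounded_multiples_eq0 _ _ M) => m.
  have := near (gen_prod (nseq m r)); rewrite big1 => [|i _].
    by rewrite sub0r normrN hprod big_nseq iter_addr_0 mulr_natl.
  rewrite phi_prod; have /andP[ms mt] := mem_marker s t i.
  have [/eqP rs|] := boolP (r == s); last first.
    move=> rs; rewrite (occ_eq0 ms) ?mulr0 //; apply/negP => /nseqP[e _].
    by rewrite e eqxx in rs.
  rewrite (occ_eq0 mt) ?mulr0 //; apply/negP => /nseqP[e _].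
  by rewrite -rs e eqxx in neq_st.
apply: (@bounded_multiples_eq0 _ _ M) => m.
(* The test words detect the single coefficient c_k, with multiplicity m. *)
have h_test : h (gen_prod (test_word s t k m)) = 0.
  rewrite hprod big1_seq // => r /andP[_ rw]; apply: h_gen.
  elim: m rw => [|m IH] /=; rewrite inE; first by move=> ->.
  rewrite inE mem_cat => /or4P[->|->||/IH] //; rewrite ?orbT //.
  by move=> /nseqP[-> _]; rewrite eqxx orbT.
have := near (gen_prod (test_word s t k m)).
rewrite h_test subr0 (bigD1 k) //= phi_prod occ_test_word // eqxx mul1n mulrC.
rewrite big1 ?addr0 // => i ik.
by rewrite phi_prod occ_test_word // val_eqE (negPf ik) mulr0.
Qed.
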